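(* Let $m,n\ge 1$ and let $B$ be the $m\times n$ rectangular chessboard. There is no closed knight's tour on $B$ (i.e. no Hamiltonian cycle in the knight's graph of $B$) that is crosspatch, i.e. in which every knight move of the tour forms a cross with some other knight move of the tour.
   Context: Represent the square in column $i$ and row $j$ of $B$ ($1\le i\le m$, $1\le j\le n$) by the point $(i,j)$ of the plane, and represent a knight move between two squares by the straight segment joining the corresponding points. Two knight moves form a cross (central cross) if the midpoints of their segments coincide. A set of knight moves (a knight graph) is called crosspatch if every move in it forms a cross with some other move in the set. *)

(* Defs.v *)
From HB Require Import structures.
From mathcomp Require Import all_boot all_order all_algebra.

Set Implicit Arguments.
Unset Strict Implicit.
Unset Printing Implicit Defensive.

Import Order.TTheory GRing.Theory Num.Theory.

(* A square is a pair (column, row), both counted from 0. *)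
Definition square (m n : nat) : finType := ('I_m * 'I_n)%type.

(* The points (i, j) with 1 <= i <= m and 1 <= j <= n; their midpoints have
   half-integer coordinates, so the rational plane suffices. *)
Definition point (m n : nat) (p : square m n) : rat * rat :=
  ((p.1).+1%:R, (p.2).+1%:R)%R.

Definition midpoint (x y : rat * rat) : rat * rat :=
  ((x.1 + y.1) / 2, (x.2 + y.2) / 2)%R.

Definition knight (m n : nat) : rel (square m n) := fun p q =>
  let dx := `|(point p).1 - (point q).1|%R in
  let dy := `|(point p).2 - (point q).2|%R in
  (dx == 1%R) && (dy == 2%R) || (dx == 2%R) && (dy == 1%R).

(* Moves are unoriented: a move is the two-element set of its end squares. *)
Definition form_cross (m n : nat) (e f : {set square m n}) : Prop :=
  e != f /\
  exists p q r s : square m n,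
    [/\ knight p q /\ e = [set p; q],
        knight r s /\ f = [set r; s]
      & midpoint (point p) (point q) = midpoint (point r) (point s)].

Definition crosspatch (m n : nat) (E : {set {set square m n}}) : Prop :=
  forall e, e \in E -> exists2 f, f \in E & form_cross e f.

(* A cyclic sequence visiting each vertex exactly once, consecutive vertices
   (and the last and the first) being adjacent; as usual for cycles in a simple
   graph, at least three vertices are required. *)
Definition hamiltonian_cycle (T : finType) (adj : rel T) (c : seq T) : Prop :=
  [/\ ucycle adj c, forall x : T, x \in c & 2 < size c].

Definition closed_tour (m n : nat) (c : seq (square m n)) : Prop :=
  hamiltonian_cycle (@knight m n) c.

Definition tour_moves (m n : nat) (c : seq (square m n)) :
    {set {set square m n}} :=
  [set [set p; next c p] | p in c].

(* Main.v *)
Require Import Defs.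
From mathcomp Require Import all_boot all_order all_algebra.
From mathcomp Require Import all_fingroup zify.

Set Implicit Arguments.
Unset Strict Implicit.
Unset Printing Implicit Defensive.

Import Order.TTheory GRing.Theory Num.Theory.

(* The centre of a cross is the midpoint of a unit segment separating two
   adjacent cells.  Each square lies on two crosses, so of the eight unit
   segments sticking out radially from the corners of a cell exactly two are
   centres.  This forces even degree at every grid vertex: the centres form the
   boundary of a set W of cells, a disjoint union of closed curves, oriented
   with W on the left.  The four cells around a vertex of the boundary are told
   apart by the parities of their coordinates.  When the vertex advances along
   a segment, two of the four cells stay around it and the other two are carried
   to new cells by the two knight moves of the cross; on parity classes this is
   a transposition.  A single closed tour visits all four cells around a vertex,
   so going once around the closed curve through that vertex permutes the four
   classes cyclically, which is odd.  But a closed lattice curve has even length,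
   so this permutation is a product of evenly many transpositions. *)

(** Pigeonhole gives a repeated iterate, and the least return time there is the exact period [L].
    This supplies a closed curve for the walk [phi], whose injectivity is never established. *)
Lemma eventually_periodic (T : eqType) (f : T -> T) (D : seq T) (x : T) :
    {in D, forall y, f y \in D} -> x \in D ->
  exists y L, [/\ y \in D, 0 < L, iter L f y = y
    & forall a b, iter a f y = iter b f y -> a = b %[mod L]].
Proof.
move=> fD xD.
have orbitD k : iter k f x \in D by elim: k => //= k; exact: fD.
have [a [l [l_gt0 al]]] : exists a l, 0 < l /\ iter (l + a) f x = iter a f x.
  have : ~~ uniq (traject f x (size D).+1).
    apply: contraT; rewrite negbK => /uniq_leq_size-/(_ D).
    rewrite size_traject ltnn => -> // y /trajectP[k _ ->]; exact: orbitD.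
  case/(uniqPn x) => a [b [ab]]; rewrite size_traject => bD.
  rewrite !nth_traject ?(ltn_trans ab) // => eq_ab.
  by exists a, (b - a); rewrite subn_gt0 subnK // ltnW.
have [|L /andP[L_gt0 /eqP Ly] Lmin] := @ex_minnP
    (fun k => (0 < k) && (iter k f (iter a f x) == iter a f x)).
  by exists l; rewrite l_gt0 -iterD al eqxx.
move: (iter a f x) (orbitD a) Ly Lmin => y yD Ly Lmin.
exists y, L; split=> //.
have iterM q : iter (q * L) f y = y by elim: q => // q IH; rewrite mulSn iterD IH.
have iter_mod k : iter k f y = iter (k %% L) f y.
  by rewrite {1}(divn_eq k L) addnC iterD iterM.
have ne r s : r < s -> s < L -> iter r f y <> iter s f y.
  move=> rs sL /(congr1 (iter (L - s) f)); rewrite -!iterD subnK 1?ltnW // Ly.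
  move=> eqy; have := Lmin (L - s + r); rewrite eqy eqxx; lia.
move=> b c; rewrite iter_mod (iter_mod c) => eq_bc.
have ltL k : k %% L < L by rewrite ltn_mod.
by case: (ltngtP (b %% L) (c %% L)) => // lt; case: (ne _ _ lt _); rewrite ?ltL.
Qed.

(** * Even degrees and the set of cells bounded by the cross centres *)

(* [V i j] says that the segment between cells (i, j) and (i + 1, j) is the centre
   of a cross, [H i j] the same for cells (i, j) and (i, j + 1).  The grid vertex
   (i, j) is the upper right corner of cell (i, j). *)
Section CrossSystem.

Variables (m n : nat) (V H : nat -> nat -> bool).

Hypothesis V_bounds : forall i j, V i j -> (0 < i < m) && (1 < j < n).
Hypothesis H_bounds : forall i j, H i j -> (1 < i < m) && (0 < j < n).
(** The terms are the radial segments at the corners of cell [(i + 1, j + 1)], counterclockwise from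
    the one below its lower left corner. *)
Hypothesis two_crosses : forall i j, i < m -> j < n ->
  V i j + V i.+1 j + H i.+2 j + H i.+2 j.+1 +
  (V i.+1 j.+2 + V i j.+2 + H i j.+1 + H i j) = 2.

(* The degree of vertex (i, j) is even: summed over the four corners of a cell,
   the degrees count each side twice and each radial segment once. *)
Lemma vertex_even i j : i <= m -> j <= n ->
  H i.+1 j = H i j (+) (V i j (+) V i j.+1).
Proof.
have V0 k : V 0 k = false by apply/negP => /V_bounds.
have H0 k : H 0 k = false by apply/negP => /H_bounds.
have H1 k : H 1 k = false by apply/negP => /H_bounds.
have V'0 k : V k 0 = false by apply/negP => /V_bounds/andP[].
have V'1 k : V k 1 = false by apply/negP => /V_bounds/andP[].
have H'0 k : H k 0 = false by apply/negP => /H_bounds/andP[].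
(* On the left and lower borders no segment is a centre; elsewhere three corners of a cell are even
   by induction, hence so is the fourth. *)
elim: i j => [|i IHi] j; first by rewrite !V0 H0 H1.
move=> im; elim: j => [|j IHj] jn; first by rewrite V'0 V'1 !H'0.
have := congr1 odd (two_crosses im jn); rewrite !oddD !oddb.
rewrite (IHj (ltnW jn)) (IHi _ (ltnW im) jn) (IHi _ (ltnW im) (ltnW jn)).
case: (V i j); case: (V i j.+1); case: (V i j.+2); case: (H i j);
case: (H i j.+1); case: (V i.+1 j); case: (V i.+1 j.+1);
by case: (V i.+1 j.+2); case: (H i.+2 j.+1).
Qed.

(* The indicator of the set of cells bounded by the cross centres: the parity of
   the number of centres to the left in the same row. *)
Definition W i j := odd (\sum_(a < i) V a j).

Lemma V_W i j : V i j = W i j (+) W i.+1 j.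
Proof. by rewrite /W big_ord_recr oddD oddb addKb. Qed.

(** Even degree at vertex [(i, j)] carries the identity from column [i] to the next, starting from
    column 0, where both sides vanish. *)
Lemma H_W i j : i <= m.+1 -> j <= n -> H i j = W i j (+) W i j.+1.
Proof.
elim: i => [|i IHi] im jn.
  by rewrite /W !big_ord0; apply/negP => /H_bounds.
rewrite vertex_even // IHi ?(ltnW im) // !V_W.
by case: (W i j); case: (W i j.+1); case: (W i.+1 j); case: (W i.+1 j.+1).
Qed.

(** Radial segments separate consecutive cells of the ring of eight around a cell, so [W] changes
    exactly twice around that ring. *)
Lemma ring_W i j : i < m -> j < n ->
  (W i j (+) W i.+1 j) + (W i.+1 j (+) W i.+2 j) +
  (W i.+2 j (+) W i.+2 j.+1) + (W i.+2 j.+1 (+) W i.+2 j.+2) +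
  ((W i.+1 j.+2 (+) W i.+2 j.+2) + (W i j.+2 (+) W i.+1 j.+2) +
  (W i j.+1 (+) W i j.+2) + (W i j (+) W i j.+1)) = 2.
Proof. by move=> im jn; rewrite -(two_crosses im jn) !V_W !H_W //; lia. Qed.

(** * The boundary of [W], oriented with [W] on the left *)

Definition goes_up i j := W i j.+1 && ~~ W i.+1 j.+1.
Definition goes_right i j := W i.+1 j.+1 && ~~ W i.+1 j.
Definition goes_down i j := W i.+1 j && ~~ W i j.
Definition goes_left i j := W i j && ~~ W i j.+1.

Definition on_boundary i j :=
  [|| goes_up i j, goes_right i j, goes_down i j | goes_left i j].

Lemma W_top i j : n <= j -> W i j = false.
Proof.
move=> nj; rewrite /W big1 // => a _.
by case: (boolP (V a j)) => // /V_bounds; lia.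
Qed.

(** Descending induction on rows: column [m] is empty because it is so one row up and no [H] centre
    lies there; further right no [V] centre changes the value. *)
Lemma W_side i j : m <= i -> W i j = false.
Proof.
move=> mi; have [k] := ubnP (n - j); elim: k i j mi => // k IHk i j mi jk.
have [jn|nj] := ltnP j n; last exact: W_top.
rewrite -(subnKC mi); elim: (i - m) => [|d IHd].
  have := H_W (leqnSn m) (ltnW jn); rewrite addn0 [W m j.+1]IHk //; last lia.
  by rewrite addbF => <-; apply/negP => /H_bounds; rewrite ltnn andbF.
have := V_W (m + d) j; rewrite addnS IHd addFb => <-.
by apply/negP => /V_bounds; lia.
Qed.

Lemma on_boundary_bounds i j : on_boundary i j -> (0 < i < m) && (0 < j < n).
Proof.
rewrite /on_boundary /goes_up /goes_right /goes_down /goes_left.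
have [jn|nj] := ltnP j n; last by rewrite !W_top // ltnW.
have [im|mi] := ltnP i m; last by rewrite !W_side // ltnW.
have := @V_bounds i j; have := @V_bounds i j.+1.
have := @H_bounds i j; have := @H_bounds i.+1 j.
rewrite !V_W (H_W (leqW (ltnW im)) (ltnW jn)) (H_W (leqW im) (ltnW jn)).
case: (W i j); case: (W i j.+1); case: (W i.+1 j); case: (W i.+1 j.+1) => //=; lia.
Qed.

Lemma ring_neighbours (s1 s2 s3 s4 s5 s6 s7 s8 : bool) :
    (s1 (+) s2) + (s2 (+) s3) + (s3 (+) s4) + (s4 (+) s5) +
    ((s6 (+) s5) + (s7 (+) s6) + (s8 (+) s7) + (s1 (+) s8)) = 2 ->
  (s2 != s3 -> s3 != s4 -> s6 = s2) /\ (s8 != s1 -> s1 != s2 -> s7 = s2).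
Proof. by case: s1 s2 s3 s4 s5 s6 s7 s8 => [] [] [] [] [] [] [] []. Qed.

(** In an alternating pattern, the ring of each upper cell makes both its changes at the cell
    diagonally opposite. The two rings then force conflicting values on cell [(i, j + 2)]. *)
Lemma no_checkerboard i j :
  on_boundary i j -> W i j = W i.+1 j.+1 -> W i j.+1 = W i.+1 j ->
  W i j = W i.+1 j.
Proof.
case/on_boundary_bounds/andP; case: i => // i /= im; case: j => // j /= jn eqP eqQ.
have [+ _] := ring_neighbours (ring_W (ltnW im) jn).
have [_] := ring_neighbours (ring_W im jn).
rewrite -eqP eqQ; case: (W i.+1 j.+1); case: (W i.+2 j.+1) => //= A B.
all: by rewrite A // in B; move/(_ isT isT): B.
Qed.

Definition phi (v : nat * nat) : nat * nat :=
  let: (i, j) := v in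
  if goes_up i j then (i, j.+1) else if goes_right i j then (i.+1, j)
  else if goes_down i j then (i, j.-1) else if goes_left i j then (i.-1, j) else v.

(** The two cells left behind lie opposite to the direction of travel. Their knight moves keep the
    parity of the coordinate changed by 2 and flip the other, so their classes are exchanged. *)
Definition tau (v : nat * nat) : {perm bool * bool} :=
  let: (i, j) := v in
  if goes_up i j then tperm (true, odd j) (false, odd j)
  else if goes_right i j then tperm (odd i, true) (odd i, false)
  else if goes_down i j then tperm (true, ~~ odd j) (false, ~~ odd j)
  else tperm (~~ odd i, true) (~~ odd i, false).

(** * Transport of parity classes along the boundary *)

Definition step (z : (nat * nat) * (bool * bool)) := (phi z.1, tau z.1 z.2).

(* Since [step] is deterministic, this is an equivalence relation, even without
   knowing that [step] is injective. *)
Definition merge z z' := exists a b, iter a step z = iter b step z'.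

Lemma merge_refl z : merge z z. Proof. by exists 0, 0. Qed.
Lemma merge_sym z z' : merge z z' -> merge z' z.
Proof. by case=> a [b eq_ab]; exists b, a. Qed.
Lemma merge_trans y x z : merge x y -> merge y z -> merge x z.
Proof.
case=> a [b ab] [c [d cd]]; exists (c + a), (b + d).
by rewrite !iterD ab -cd -!iterD addnC.
Qed.
Lemma merge_step z : merge z (step z). Proof. by exists 1, 0. Qed.

Lemma step_up i j c : goes_up i j ->
  step ((i, j), c) = ((i, j.+1), tperm (true, odd j) (false, odd j) c).
Proof. by rewrite /step /= => ->. Qed.

Lemma step_right i j c : goes_right i j ->
  step ((i, j), c) = ((i.+1, j), tperm (odd i, true) (odd i, false) c).
Proof.
move=> rightP; rewrite /step /= rightP.
by move: rightP; rewrite /goes_up => /andP[-> _]; rewrite andbF.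
Qed.

(** [phi] tests the opposite direction first; both could hold only in a checkerboard pattern. *)
Lemma step_down i j c : goes_down i j.+1 ->
  step ((i, j.+1), c) = ((i, j), tperm (true, odd j) (false, odd j) c).
Proof.
move=> downP; have := @no_checkerboard i j.+1.
rewrite /step /= downP /on_boundary downP !orbT negbK; move: downP.
rewrite /goes_up /goes_right /goes_down.
by case: (W i j.+1); case: (W i.+1 j.+1); case: (W i j.+2); case: (W i.+1 j.+2)
  => //= _ /(_ isT erefl erefl).
Qed.

Lemma step_left i j c : goes_left i.+1 j ->
  step ((i.+1, j), c) = ((i, j), tperm (odd i, true) (odd i, false) c).
Proof.
move=> leftP; have := @no_checkerboard i.+1 j.
rewrite /step /= leftP /on_boundary leftP !orbT negbK; move: leftP.
rewrite /goes_up /goes_right /goes_down /goes_left.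
by case: (W i.+1 j); case: (W i.+2 j); case: (W i.+1 j.+1); case: (W i.+2 j.+1)
  => //= _ /(_ isT erefl erefl).
Qed.

(** The walk uses this segment in one direction; symmetry of [merge] and involutivity of the
    transposition give the other. *)
Lemma merge_V i j c : V i j.+1 ->
  merge ((i, j), c) ((i, j.+1), tperm (true, odd j) (false, odd j) c).
Proof.
rewrite V_W => diff.
have [upP|dnP] : goes_up i j \/ goes_down i j.+1.
- by move: diff; rewrite /goes_up /goes_down; case: (W i j.+1) (W i.+1 j.+1) => [] []; auto.
- by rewrite -step_up //; exact: merge_step.
- apply: merge_sym; rewrite -{2}(tpermK (true, odd j) (false, odd j) c).
  by rewrite -(step_down _ dnP); exact: merge_step.
Qed.

Lemma merge_H i j c : H i.+1 j ->
  merge ((i, j), c) ((i.+1, j), tperm (odd i, true) (odd i, false) c).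
Proof.
move=> Hij; have /andP[/andP[_ im] /andP[_ jn]] := H_bounds Hij.
move: Hij; rewrite H_W 1?ltnW // 1?ltnW // => diff.
have [rgP|lfP] : goes_right i j \/ goes_left i.+1 j.
- by move: diff; rewrite /goes_right /goes_left; case: (W i.+1 j) (W i.+1 j.+1) => [] []; auto.
- by rewrite -step_right //; exact: merge_step.
- apply: merge_sym; rewrite -{2}(tpermK (odd i, true) (odd i, false) c).
  by rewrite -(step_left _ lfP); exact: merge_step.
Qed.

(* Going around the cell of colour [s], whose neighbours are [r1], ..., [r8] in
   cyclic order from the lower left: its corners on the boundary are joined by
   its sides on the boundary. *)
Lemma corner_paths (s r1 r2 r3 r4 r5 r6 r7 r8 : bool) :
    (r1 (+) r2) + (r2 (+) r3) + (r3 (+) r4) + (r4 (+) r5) +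
    ((r6 (+) r5) + (r7 (+) r6) + (r8 (+) r7) + (r1 (+) r8)) = 2 ->
  let corner a b c := [|| s != a, s != b | s != c] in
  let sw := corner r8 r1 r2 in let se := corner r2 r3 r4 in
  let ne := corner r4 r5 r6 in let nw := corner r6 r7 r8 in
  let south := s != r2 in let east := s != r4 in
  let north := s != r6 in let west := s != r8 in
  [&& sw && se ==> south || [&& east, north & west],
      se && ne ==> east || [&& north, west & south],
      ne && nw ==> north || [&& west, south & east],
      nw && sw ==> west || [&& south, east & north],
      sw && ne ==> (south && east) || (west && north) &
      se && nw ==> (east && north) || (south && west)].
Proof. by case: s r1 r2 r3 r4 r5 r6 r7 r8 => [] [] [] [] [] [] [] [] []. Qed.

Definition around (x v : nat * nat) :=
  ((x.1 == v.1) || (x.1 == v.1.+1)) && ((x.2 == v.2) || (x.2 == v.2.+1)).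

Definition parity (x : nat * nat) := (odd x.1, odd x.2).

Lemma on_boundary_neq i j : on_boundary i j =
  ~~ [&& W i j == W i.+1 j, W i j == W i j.+1 & W i j == W i.+1 j.+1].
Proof.
rewrite /on_boundary /goes_up /goes_right /goes_down /goes_left.
by case: (W i j) (W i.+1 j) (W i j.+1) (W i.+1 j.+1) => [] [] [] [].
Qed.

(** Sliding the vertex along a side of a cell leaves the class of that cell fixed, and
    [corner_paths] joins its boundary corners by such sides. *)
Lemma merge_corners i j v v' : i < m -> j < n ->
    around (i.+1, j.+1) v -> around (i.+1, j.+1) v' ->
    on_boundary v.1 v.2 -> on_boundary v'.1 v'.2 ->
  merge (v, parity (i.+1, j.+1)) (v', parity (i.+1, j.+1)).
Proof.
move=> im jn; set c := parity _.
have fixH : tperm (odd i, true) (odd i, false) c = c.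
  by apply: tpermD; rewrite /c /parity /= xpair_eqE; case: (odd i).
have fixV : tperm (true, odd j) (false, odd j) c = c.
  by apply: tpermD; rewrite /c /parity /= xpair_eqE; case: (odd j); rewrite andbF.
pose s := W i.+1 j.+1.
have mS : s != W i.+1 j -> merge ((i, j), c) ((i.+1, j), c).
  move=> ne; rewrite -{2}fixH; apply: merge_H.
  by rewrite (H_W (leqW im) (ltnW jn)) addbC -negb_eqb.
have mN : s != W i.+1 j.+2 -> merge ((i, j.+1), c) ((i.+1, j.+1), c).
  by move=> ne; rewrite -{2}fixH; apply: merge_H; rewrite (H_W (leqW im) jn) -negb_eqb.
have mW : s != W i j.+1 -> merge ((i, j), c) ((i, j.+1), c).
  by move=> ne; rewrite -{2}fixV; apply: merge_V; rewrite V_W addbC -negb_eqb.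
have mE : s != W i.+2 j.+1 -> merge ((i.+1, j), c) ((i.+1, j.+1), c).
  by move=> ne; rewrite -{2}fixV; apply: merge_V; rewrite V_W -negb_eqb.
have /and5P[SWSE SENE NENW NWSW /andP[SWNE SENW]] :=
  corner_paths s (ring_W im jn).
have on a b : on_boundary a b ->
    [|| s != W a b, s != W a.+1 b, s != W a b.+1 | s != W a.+1 b.+1].
  rewrite on_boundary_neq.
  by move: (s) (W a b) (W a.+1 b) (W a b.+1) (W a.+1 b.+1) => [] [] [] [] [].
have cSW : on_boundary i j -> [|| s != W i j.+1, s != W i j | s != W i.+1 j].
  by case/on/or4P => [->|->|->|]; rewrite ?orbT ?eqxx.
have cSE : on_boundary i.+1 j ->
    [|| s != W i.+1 j, s != W i.+2 j | s != W i.+2 j.+1].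
  by case/on/or4P => [->|->||->]; rewrite ?orbT ?eqxx.
have cNE : on_boundary i.+1 j.+1 ->
    [|| s != W i.+2 j.+1, s != W i.+2 j.+2 | s != W i.+1 j.+2].
  by case/on/or4P => [|->|->|->]; rewrite ?orbT ?eqxx.
have cNW : on_boundary i j.+1 ->
    [|| s != W i.+1 j.+2, s != W i j.+2 | s != W i j.+1].
  by case/on/or4P => [->||->|->]; rewrite ?orbT ?eqxx.
have pS : on_boundary i j -> on_boundary i.+1 j ->
    merge ((i, j), c) ((i.+1, j), c).
  move=> /cSW a /cSE b; have /orP[/mS //|/and3P[/mE e /mN n' /mW w]] :=
    implyP SWSE (introT andP (conj a b)).
  exact: merge_trans w (merge_trans n' (merge_sym e)).
have pE : on_boundary i.+1 j -> on_boundary i.+1 j.+1 ->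
    merge ((i.+1, j), c) ((i.+1, j.+1), c).
  move=> /cSE a /cNE b; have /orP[/mE //|/and3P[/mN n' /mW w /mS s']] :=
    implyP SENE (introT andP (conj a b)).
  exact: merge_trans (merge_sym s') (merge_trans w n').
have pN : on_boundary i j.+1 -> on_boundary i.+1 j.+1 ->
    merge ((i, j.+1), c) ((i.+1, j.+1), c).
  move=> /cNW b /cNE a; have /orP[/mN //|/and3P[/mW w /mS s' /mE e]] :=
    implyP NENW (introT andP (conj a b)).
  exact: merge_trans (merge_sym w) (merge_trans s' e).
have pW : on_boundary i j -> on_boundary i j.+1 ->
    merge ((i, j), c) ((i, j.+1), c).
  move=> /cSW b /cNW a; have /orP[/mW //|/and3P[/mS s' /mE e /mN n']] :=
    implyP NWSW (introT andP (conj a b)).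
  exact: merge_trans s' (merge_trans e (merge_sym n')).
have pSWNE : on_boundary i j -> on_boundary i.+1 j.+1 ->
    merge ((i, j), c) ((i.+1, j.+1), c).
  move=> /cSW a /cNE b.
  have /orP[/andP[/mS s' /mE e]|/andP[/mW w /mN n']] :=
    implyP SWNE (introT andP (conj a b)).
    exact: merge_trans s' e.
  exact: merge_trans w n'.
have pSENW : on_boundary i.+1 j -> on_boundary i j.+1 ->
    merge ((i.+1, j), c) ((i, j.+1), c).
  move=> /cSE a /cNW b.
  have /orP[/andP[/mE e /mN n']|/andP[/mS s' /mW w]] :=
    implyP SENW (introT andP (conj a b)).
    exact: merge_trans e (merge_sym n').
  exact: merge_trans (merge_sym s') w.
rewrite /around; case: v v' => [a b] [a' b'] /= /andP[/orP[/eqP<-|/eqP[<-]] /orP[/eqP<-|/eqP[<-]]];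
  move=> /andP[/orP[/eqP<-|/eqP[<-]] /orP[/eqP<-|/eqP[<-]]] on1 on2;
  first [exact: merge_refl | by auto | by apply: merge_sym; auto].
Qed.

(** * Closed boundary curves and the sign of their holonomy *)

Lemma phi_on v : on_boundary v.1 v.2 -> on_boundary (phi v).1 (phi v).2.
Proof.
case: v => i j /= on; have /andP[/andP[i0 _] /andP[j0 _]] := on_boundary_bounds on.
case: i j i0 j0 on => // i [] // j _ _; rewrite /phi {1}/on_boundary.
case: ifP => [/andP[A /negPf B] _|_]; first by rewrite on_boundary_neq /= A B.
case: ifP => [/andP[A /negPf B] _|_]; first by rewrite on_boundary_neq /= A B andbF.
case: ifP => [/andP[A /negPf B] _|_].
  by rewrite on_boundary_neq /= A B; case: (W i.+1 j); rewrite ?andbF.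
case: ifP => // /andP[A /negPf B] _.
by rewrite on_boundary_neq /= A B; case: (W i j.+1); rewrite ?andbF.
Qed.

Lemma phi_odd v : on_boundary v.1 v.2 ->
  odd ((phi v).1 + (phi v).2) = ~~ odd (v.1 + v.2).
Proof.
case: v => i j /= on; have /andP[/andP[i0 _] /andP[j0 _]] := on_boundary_bounds on.
move: on; rewrite /on_boundary /phi.
do 3! [case: ifP => [_ _ /=|_]; first lia].
by case: ifP => // _ _ /=; lia.
Qed.

Lemma tau_odd v : odd_perm (tau v).
Proof.
case: v => i j; rewrite /tau.
by do 3!(case: ifP => _; first by rewrite odd_tperm xpair_eqE ?eqxx ?andbF);
  rewrite odd_tperm xpair_eqE ?eqxx ?andbF.
Qed.

Fixpoint holonomy v t : {perm bool * bool} :=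
  if t is t'.+1 then (tau v * holonomy (phi v) t')%g else 1%g.

Lemma iter_step t v c : iter t step (v, c) = (iter t phi v, holonomy v t c).
Proof.
elim: t v c => [|t IH] v c; first by rewrite /= perm1.
by rewrite !iterSr IH /= permM.
Qed.

Lemma holonomyD v a b :
  holonomy v (a + b) = (holonomy v a * holonomy (iter a phi v) b)%g.
Proof.
elim: a v => [|a IH] v; first by rewrite mul1g.
by rewrite addSn iterSr /= IH mulgA.
Qed.

Lemma odd_holonomy v t : odd_perm (holonomy v t) = odd t.
Proof. by elim: t v => [|t IH] v /=; rewrite ?odd_perm1 // odd_permM tau_odd IH. Qed.

(** A single orbit on four points is a 4-cycle. *)
Lemma transitive_odd_perm (s : {perm bool * bool}) x :
  (forall y, y \in porbit s x) -> odd_perm s.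
Proof.
move=> tr; rewrite /odd_perm; suff -> : porbits s = [set porbit s x].
  by rewrite cards1 card_prod card_bool.
apply/setP => A; rewrite inE; apply/imsetP/eqP => [[y _ ->]|->]; last by exists x.
by apply/eqP; rewrite eq_porbit_mem.
Qed.

Hypothesis m_gt0 : 0 < m.
Hypothesis n_gt0 : 0 < n.
(** Connectedness of the graph formed by the two moves of every cross, phrased through invariant
    properties. *)
Hypothesis moves_connect : forall A : nat -> nat -> Prop,
    (forall i j, V i j -> (A i j.-1 <-> A i.+1 j.+1) /\
                          (A i.+1 j.-1 <-> A i j.+1)) ->
    (forall i j, H i j -> (A i.-1 j <-> A i.+1 j.+1) /\
                          (A i.-1 j.+1 <-> A i.+1 j)) ->
  forall i j i' j', i < m -> j < n -> i' < m -> j' < n ->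
  A i.+1 j.+1 -> A i'.+1 j'.+1.

(** Otherwise the whole ring around cell [(1, 1)] would have one value of [W], against its two
    changes. *)
Lemma exists_boundary : exists v, on_boundary v.1 v.2.
Proof.
have [//|no] := boolP (on_boundary 0 0 || on_boundary 1 0 || on_boundary 0 1
   || on_boundary 1 1).
  by move=> /orP[/orP[/orP[]|]|]; [exists (0, 0)|exists (1, 0)|exists (0, 1)|exists (1, 1)].
exfalso; move: no (ring_W m_gt0 n_gt0); rewrite !on_boundary_neq -!negb_and negbK.
move=> /andP[/andP[/andP[]]] /and3P[/eqP<- /eqP<- /eqP<-].
move=> /and3P[/eqP<- _ /eqP<-] /and3P[_ /eqP<- /eqP<-] /and3P[_ _ /eqP<-].
by rewrite addbb.
Qed.

Lemma around_bounds x v : on_boundary v.1 v.2 -> around x v ->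
  (0 < x.1 <= m) && (0 < x.2 <= n).
Proof. by move/on_boundary_bounds; rewrite /around; lia. Qed.

Lemma merge_around x v v' : around x v -> around x v' ->
    on_boundary v.1 v.2 -> on_boundary v'.1 v'.2 ->
  merge (v, parity x) (v', parity x).
Proof.
move=> xv xv' on on'; move: (around_bounds on xv) (xv) (xv').
case: x {xv xv'} => [[|i] [|j]] //=; rewrite ?andbF // => /andP[im jn] xv xv'.
exact: merge_corners.
Qed.

Lemma no_connected_crosses : False.
Proof.
have [v1 on1] := exists_boundary.
pose D := [seq v <- [seq (i, j) | i <- iota 0 m, j <- iota 0 n] | on_boundary v.1 v.2].
have memD v : (v \in D) = on_boundary v.1 v.2.
  rewrite mem_filter andb_idr // => /on_boundary_bounds/andP[/andP[_ im] /andP[_ jn]].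
  by case: v im jn => i j /= im jn; apply: allpairs_f; rewrite mem_iota.
have [||v [L [vD L_gt0 phiL periodic]]] := @eventually_periodic _ phi D v1.
- by move=> v; rewrite !memD; exact: phi_on.
- by rewrite memD.
rewrite memD in vD.
have on_iter t : on_boundary (iter t phi v).1 (iter t phi v).2.
  by elim: t => //= t; exact: phi_on.
have evenL : odd L = false.
  have : odd ((iter L phi v).1 + (iter L phi v).2) = odd L (+) odd (v.1 + v.2).
    elim: L {L_gt0 phiL periodic} => [|t IH] //=.
    by rewrite phi_odd // IH addNb.
  by rewrite phiL; case: (odd L); case: (odd _).
(* The reference label is that of cell [v] seen from vertex [v], its upper right corner. *)
pose A a b := forall u, on_boundary u.1 u.2 -> around (a, b) u ->
  merge (v, parity v) (u, parity (a, b)).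
have A_iff x y u w : on_boundary u.1 u.2 -> on_boundary w.1 w.2 ->
    around x u -> around y w -> merge (u, parity x) (w, parity y) ->
    (A x.1 x.2 <-> A y.1 y.2).
  move=> onu onw xu yw m_uw; rewrite /A -!surjective_pairing; split=> Ax t ont.
    move=> yt; apply: merge_trans (merge_trans (Ax u onu xu) m_uw) _.
    exact: merge_around.
  move=> xt; apply: merge_trans (merge_trans (Ax w onw yw) (merge_sym m_uw)) _.
  exact: merge_around.
have Av : A v.1 v.2.
  move=> u onu; rewrite -surjective_pairing => vu.
  by apply: merge_around; rewrite // /around !eqxx.
(* The two ends of a move touch opposite ends of the segment, and its transposition exchanges their
   parity classes. *)
have A_V i j : V i j -> (A i j.-1 <-> A i.+1 j.+1) /\ (A i.+1 j.-1 <-> A i j.+1).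
  move=> Vij; have /andP[_ /andP[j0 _]] := V_bounds Vij.
  case: j j0 Vij => // j _ Vij; have mV := merge_V _ Vij.
  have on_d : on_boundary i j.
    rewrite on_boundary_neq; move: Vij; rewrite V_W.
    by case: (W i j) (W i.+1 j) (W i j.+1) (W i.+1 j.+1) => [] [] [] [].
  have on_u : on_boundary i j.+1.
    rewrite on_boundary_neq; move: Vij; rewrite V_W.
    by case: (W i j.+1) (W i.+1 j.+1) => [] [].
  split; [apply: (A_iff (i, j) (i.+1, j.+2) (i, j) (i, j.+1))
         |apply: (A_iff (i.+1, j) (i, j.+2) (i, j) (i, j.+1))];
    rewrite /around /= ?eqxx ?orbT //.
    have := mV (parity (i, j)); rewrite /parity /= negbK.
    by case: (odd i); rewrite ?tpermL ?tpermR.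
  have := mV (parity (i.+1, j)); rewrite /parity /= negbK.
  by case: (odd i); rewrite ?tpermL ?tpermR.
have A_H i j : H i j -> (A i.-1 j <-> A i.+1 j.+1) /\ (A i.-1 j.+1 <-> A i.+1 j).
  move=> Hij; have /andP[/andP[i0 im] /andP[_ jn]] := H_bounds Hij.
  case: i i0 im Hij => // i _ im Hij; have mH := merge_H _ Hij.
  have := Hij; rewrite (H_W (leqW (ltnW im)) (ltnW jn)) => neW.
  have on_l : on_boundary i j.
    rewrite on_boundary_neq; move: neW.
    by case: (W i j) (W i.+1 j) (W i j.+1) (W i.+1 j.+1) => [] [] [] [].
  have on_r : on_boundary i.+1 j.
    rewrite on_boundary_neq; move: neW.
    by case: (W i.+1 j) (W i.+2 j) (W i.+1 j.+1) => [] [] [].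
  split; [apply: (A_iff (i, j) (i.+2, j.+1) (i, j) (i.+1, j))
         |apply: (A_iff (i, j.+1) (i.+2, j) (i, j) (i.+1, j))];
    rewrite /around /= ?eqxx ?orbT //.
    have := mH (parity (i, j)); rewrite /parity /= negbK.
    by case: (odd j); rewrite ?tpermL ?tpermR.
  have := mH (parity (i, j.+1)); rewrite /parity /= negbK.
  by case: (odd j); rewrite ?tpermL ?tpermR.
have A_all x : around x v -> A x.1 x.2.
  move=> xv; move: (around_bounds vD xv) (on_boundary_bounds vD) Av.
  case: x {xv} => [[|a] [|b]] //=; rewrite ?andbF //.
  case: (v) => [[|i] [|j]] //=; rewrite ?andbF // => /andP[am bn] /andP[im jn].
  by apply: (moves_connect A_V A_H) => //; exact: ltnW.
suff : odd_perm (holonomy v L) by rewrite odd_holonomy evenL.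
apply: (@transitive_odd_perm _ (parity v)) => c.
have holoM q r : holonomy v (q * L + r) = (holonomy v L ^+ q * holonomy v r)%g.
  elim: q => [|q IH]; first by rewrite mul1g.
  by rewrite mulSn -addnA holonomyD phiL IH mulgA expgS.
have [x xv <-] : exists2 x, around x v & parity x = c.
  case: c => c d; exists (v.1 + (odd v.1 (+) c), v.2 + (odd v.2 (+) d)).
    rewrite /around /=; case: (_ (+) c); case: (_ (+) d);
    by rewrite ?addn0 ?addn1 !eqxx ?orbT.
  by rewrite /parity /= !oddD !oddb !addKb.
have [a [b]] := A_all x xv v vD ltac:(by rewrite -surjective_pairing).
(* Both walks end at the same vertex, so [a] and [b] agree modulo [L]; cancelling the common
   remainder puts both parities in one orbit of [holonomy v L]. *)
rewrite -surjective_pairing !iter_step => -[/periodic eq_ab].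
rewrite (divn_eq a L) (divn_eq b L) !holoM eq_ab !permM => /perm_inj eq_v.
rewrite -eq_porbit_mem -(porbit_perm _ (b %/ L)) -(porbit_perm _ (a %/ L) (parity v)).
by rewrite eq_v.
Qed.
End CrossSystem.

(** * Knight moves and midpoints in integer coordinates *)

Lemma dist_natr (R : numDomainType) (a b : nat) :
  (`|a%:R - b%:R| = ((a - b) + (b - a))%:R :> R)%R.
Proof.
wlog le_ba: a b / b <= a => [IH|].
  by case/orP: (leq_total b a) => le; [rewrite IH | rewrite distrC addnC IH].
by rewrite -natrB // normr_nat (eqP le_ba) addn0.
Qed.

Definition pos m n (p : square m n) : nat * nat := ((p.1).+1, (p.2).+1).

Lemma pos_inj m n : injective (@pos m n).
Proof. by move=> [a b] [a' b'] [/val_inj-> /val_inj->]. Qed.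

Definition knight_step (x y : nat * nat) :=
  ((x.1 == y.1.+1) || (y.1 == x.1.+1)) && ((x.2 == y.2.+2) || (y.2 == x.2.+2)) ||
  ((x.1 == y.1.+2) || (y.1 == x.1.+2)) && ((x.2 == y.2.+1) || (y.2 == x.2.+1)).

(** By parity of the coordinate sums, both moves have the same displacements up to sign, so they are
    the two diagonals of one rectangle with sides 1 and 2. *)
Lemma knight_step_cross (x y z w : nat * nat) :
    knight_step x y -> knight_step z w ->
    x.1 + y.1 = z.1 + w.1 -> x.2 + y.2 = z.2 + w.2 -> z != x -> w != x ->
  z = (x.1, y.2) /\ w = (y.1, x.2) \/ z = (y.1, x.2) /\ w = (x.1, y.2).
Proof.
case: x y z w => [x1 x2] [y1 y2] [z1 z2] [w1 w2].
rewrite /knight_step !xpair_eqE /= => xy zw e1 e2 zx wx.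
have [[e3 e4]|[e3 e4]] : (z1 = x1 /\ z2 = y2) \/ (z1 = y1 /\ z2 = x2).
  by move: xy => /orP[] /andP[/orP[]/eqP xy1 /orP[]/eqP xy2]; subst; lia.
  by left; clear -e1 e2 e3 e4; split; congr (_, _); lia.
by right; clear -e1 e2 e3 e4; split; congr (_, _); lia.
Qed.

Lemma knight_pos m n (p q : square m n) :
  knight p q = knight_step (pos p) (pos q).
Proof. by rewrite /knight /knight_step !dist_natr !pnatr_eq1 !eqr_nat /=; lia. Qed.

Lemma midpoint_pos m n (p q r s : square m n) :
  midpoint (point p) (point q) = midpoint (point r) (point s) ->
  ((pos p).1 + (pos q).1 = (pos r).1 + (pos s).1 /\
   (pos p).2 + (pos q).2 = (pos r).2 + (pos s).2)%N.
Proof.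
have two0 : (2 != 0 :> rat)%R by [].
rewrite /midpoint /= => -[/(mulIf (invr_neq0 two0)) e1 /(mulIf (invr_neq0 two0)) e2].
by move: e1 e2; rewrite -!natrD => /eqP + /eqP; rewrite !eqr_nat => /eqP + /eqP.
Qed.

Lemma next_next_neq (T : eqType) (c : seq T) x :
  uniq c -> x \in c -> 2 < size c -> next c (next c x) != x.
Proof.
move=> Uc cx; case: (rot_to cx) => k s def_c sc.
have e := next_rot k Uc; rewrite -!e def_c; move: (rot_uniq k c) (size_rot k c).
rewrite def_c Uc => + eq_size; rewrite -eq_size in sc.
case: s sc {e def_c eq_size} => [|y [|z s]] //= _ /and3P[].
rewrite !inE !negb_or => /and3P[xy xz _] _ _.
by rewrite eqxx [y == x]eq_sym (negPf xy) eqxx eq_sym.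
Qed.

(** * The tour as a connected cross system *)

Section Tour.

Variables (m n : nat) (c : seq (square m n)).
Hypothesis tour_c : closed_tour c.
Hypothesis cross_c : crosspatch (tour_moves c).

Let Uc : uniq c. Proof. by case: tour_c => /andP[]. Qed.
Let mem_c p : p \in c. Proof. by case: tour_c. Qed.
Let knight_next p : knight p (next c p).
Proof. by case: tour_c => /andP[/next_cycle/(_ (mem_c p))]. Qed.

Definition joined p q := (next c p == q) || (next c q == p).

Lemma joined_knight p q : joined p q -> knight p q.
Proof.
case/orP=> /eqP<-; first exact: knight_next.
by have := knight_next q; rewrite !knight_pos /knight_step; lia.
Qed.

Lemma joined_sym p q : joined p q = joined q p.
Proof. exact: orbC. Qed.

Lemma mem_tour_moves p q : p != q -> ([set p; q] \in tour_moves c) = joined p q.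
Proof.
move=> ne_pq; apply/imsetP/orP => [[x _ eq_pq]|[]/eqP<-]; first last.
- by exists q; rewrite // setUC.
- by exists p.
have := set21 p q; have := set22 p q; rewrite eq_pq !inE.
case/orP=> /eqP eq /orP[]/eqP ep; move: ne_pq; rewrite eq ep ?eqxx // => _.
  by right.
by left.
Qed.

Lemma joined_cross p q : joined p q -> joined (p.1, q.2) (q.1, p.2).
Proof.
move=> pq; have kpq := joined_knight pq.
have ne (x y : square m n) : knight x y -> x != y.
  by rewrite knight_pos => k; apply: contraTneq k => ->; rewrite /knight_step; lia.
have := pq; rewrite -mem_tour_moves ?ne // => /cross_c[f f_in].
case=> ne_pqf [p' [q' [r [s [[kpq' eq_pq] [krs eq_f] mid]]]]].
move: f_in; rewrite eq_f mem_tour_moves ?ne // => rs.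
have [mid1 mid2] : ((pos p).1 + (pos q).1 = (pos r).1 + (pos s).1 /\
                    (pos p).2 + (pos q).2 = (pos r).2 + (pos s).2)%N.
  have [e1 e2] := midpoint_pos mid.
  have := set21 p q; have := set22 p q; rewrite eq_pq !inE.
  move=> /orP[]/eqP eq /orP[]/eqP ep; first 1 last.
  - by rewrite eq ep; split; rewrite addnC.
  - by rewrite eq ep.
  - by have := ne _ _ kpq; rewrite eq ep eqxx.
  - by have := ne _ _ kpq; rewrite eq ep eqxx.
move: kpq krs; rewrite !knight_pos => kpq krs.
have [eq_pr|ne_pr] := eqVneq (pos r) (pos p).
  case/eqP: ne_pqf; rewrite eq_f (pos_inj eq_pr); congr [set _; _].
  apply: pos_inj; move: mid1 mid2; rewrite eq_pr => /addnI + /addnI.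
  by case: (pos q) (pos s) => [? ?] [? ?] /= -> ->.
have [eq_ps|ne_ps] := eqVneq (pos s) (pos p).
  case/eqP: ne_pqf; rewrite eq_f (pos_inj eq_ps) setUC; congr [set _; _].
  apply: pos_inj; move: mid1 mid2; rewrite eq_ps => + +.
  rewrite [((pos r).1 + _)%N]addnC [((pos r).2 + _)%N]addnC => /addnI + /addnI.
  by case: (pos q) (pos r) => [? ?] [? ?] /= -> ->.
have [[er es]|[er es]] := knight_step_cross kpq krs mid1 mid2 ne_pr ne_ps.
  by rewrite -[(p.1, q.2)](@pos_inj _ _ r) // -[(q.1, p.2)](@pos_inj _ _ s).
rewrite joined_sym.
by rewrite -[(p.1, q.2)](@pos_inj _ _ s) // -[(q.1, p.2)](@pos_inj _ _ r).
Qed.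

Definition adj x y :=
  [exists p, exists q, [&& pos p == x, pos q == y & joined p q]].

Lemma adjP x y : reflect (exists p q, [/\ pos p = x, pos q = y & joined p q]) (adj x y).
Proof.
apply: (iffP existsP) => -[p].
  by move/existsP => [q /and3P[/eqP ? /eqP ? ?]]; exists p, q.
by case=> q [<- <- pq]; exists p; apply/existsP; exists q; rewrite !eqxx.
Qed.

Lemma adj_sym x y : adj x y = adj y x.
Proof.
by apply/adjP/adjP => -[p [q [px qy pq]]]; exists q, p; rewrite joined_sym.
Qed.

Lemma adj_cross a b a' b' : adj (a, b) (a', b') = adj (a, b') (a', b).
Proof.
suff imp d d' : adj (a, d) (a', d') -> adj (a, d') (a', d) by apply/idP/idP; apply: imp.
case/adjP=> p [q [[<- <-] [<- <-] /joined_cross pq]].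
by apply/adjP; exists (p.1, q.2), (q.1, p.2).
Qed.

(** The sum may replace a disjunction because successor and predecessor differ on a cycle of length
    at least 3. *)
Lemma adj_pos p y :
  adj (pos p) y = (pos (next c p) == y) + (pos (prev c p) == y) :> nat.
Proof.
have -> : adj (pos p) y = (pos (next c p) == y) || (pos (prev c p) == y).
  apply/adjP/orP => [[p' [q [/pos_inj-> <-]]]|].
    by case/orP=> /eqP <-; [left | right; rewrite prev_next].
  case=> /eqP <-; [exists p, (next c p) | exists p, (prev c p)];
  by rewrite /joined ?next_prev // eqxx ?orbT.
have [<-|_] := pos (next c p) =P y; last by [].
suff /negPf-> : pos (prev c p) != pos (next c p) by [].
apply: contraTneq (next_next_neq Uc (mem_c p) _) => [/pos_inj<-|]; last by case: tour_c.
by rewrite next_prev // eqxx.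
Qed.

Lemma adj_bounds x y : adj x y ->
  [&& knight_step x y, 0 < x.1 <= m, 0 < x.2 <= n, 0 < y.1 <= m & 0 < y.2 <= n].
Proof.
by case/adjP=> p [q [<- <- /joined_knight]]; rewrite knight_pos => ->; rewrite /= !ltn_ord.
Qed.

(* For [j = 0] or [i = 0] the truncated predecessor denotes row or column 0, which
   is off the board, so these are false as they should be. *)
Definition Vcross i j := adj (i, j.-1) (i.+1, j.+1).
Definition Hcross i j := adj (i.-1, j) (i.+1, j.+1).

Lemma Vcross_bounds i j : Vcross i j -> (0 < i < m) && (1 < j < n).
Proof. by move/adj_bounds; rewrite /=; lia. Qed.

Lemma Hcross_bounds i j : Hcross i j -> (1 < i < m) && (0 < j < n).
Proof. by move/adj_bounds; rewrite /=; lia. Qed.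

Lemma knight_step_targets i j x : knight_step (i.+1, j.+1) x -> 0 < x.1 -> 0 < x.2 ->
  (x == (i, j.-1)) + (x == (i.+2, j.-1)) + (x == (i.+3, j)) + (x == (i.+3, j.+2)) +
  ((x == (i.+2, j.+3)) + (x == (i, j.+3)) + (x == (i.-1, j.+2)) + (x == (i.-1, j))) = 1.
Proof.
case: x => a b; rewrite /knight_step !xpair_eqE /= => + a0 b0.
have unique k d : 0 < d -> (d == k) + (d == k.+2) + (d == k.+3) + (d == k.-1) <= 1.
  by lia.
have eq1 k d : (k.+1 == d.+1) = (d == k) by rewrite eqSS eq_sym.
have eq2 k d : 0 < d -> (k.+1 == d.+2) = (d == k.-1) by lia.
rewrite !eq2 // !eq1; move: (unique i a a0) (unique j b b0).
case: (a == i); case: (a == i.+2); case: (a == i.+3); case: (a == i.-1) => //= _;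
by case: (b == j); case: (b == j.+2); case: (b == j.+3); case: (b == j.-1).
Qed.

(** Up to exchanging the moves of a cross, the terms are the eight knight moves from one square; the
    tour uses two of them. *)
Lemma two_crosses_tour i j : i < m -> j < n ->
  Vcross i j + Vcross i.+1 j + Hcross i.+2 j + Hcross i.+2 j.+1 +
  (Vcross i.+1 j.+2 + Vcross i j.+2 + Hcross i j.+1 + Hcross i j) = 2.
Proof.
move=> im jn; pose p : square m n := (Ordinal im, Ordinal jn).
have -> : Vcross i j = adj (pos p) (i, j.-1) by rewrite adj_sym.
have -> : Vcross i.+1 j = adj (pos p) (i.+2, j.-1) by rewrite /Vcross adj_cross.
have -> : Hcross i.+2 j = adj (pos p) (i.+3, j) by rewrite /Hcross adj_cross.
have -> : Hcross i.+2 j.+1 = adj (pos p) (i.+3, j.+2) by [].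
have -> : Vcross i.+1 j.+2 = adj (pos p) (i.+2, j.+3) by [].
have -> : Vcross i j.+2 = adj (pos p) (i, j.+3) by rewrite /Vcross adj_cross adj_sym.
have -> : Hcross i j.+1 = adj (pos p) (i.-1, j.+2) by rewrite /Hcross adj_cross adj_sym.
have -> : Hcross i j = adj (pos p) (i.-1, j) by rewrite adj_sym.
have joined_next : joined p (next c p) by rewrite /joined eqxx.
have joined_prev : joined p (prev c p) by rewrite /joined next_prev // eqxx orbT.
have add8 a1 a2 a3 a4 a5 a6 a7 a8 b1 b2 b3 b4 b5 b6 b7 b8 :
    a1 + a2 + a3 + a4 + (a5 + a6 + a7 + a8) = 1 ->
    b1 + b2 + b3 + b4 + (b5 + b6 + b7 + b8) = 1 ->
    (a1 + b1) + (a2 + b2) + (a3 + b3) + (a4 + b4) +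
    ((a5 + b5) + (a6 + b6) + (a7 + b7) + (a8 + b8)) = 2 by lia.
have := joined_knight joined_next; have := joined_knight joined_prev.
rewrite !knight_pos => /knight_step_targets prevE /knight_step_targets nextE.
by rewrite !adj_pos; apply: add8; [exact: nextE | exact: prevE].
Qed.

(** Every tour move is a move of its own cross, so [A] passes along [next c], which reaches every
    square. *)
Lemma tour_connect (A : nat -> nat -> Prop) :
    (forall i j, Vcross i j -> (A i j.-1 <-> A i.+1 j.+1) /\
                               (A i.+1 j.-1 <-> A i j.+1)) ->
    (forall i j, Hcross i j -> (A i.-1 j <-> A i.+1 j.+1) /\
                               (A i.-1 j.+1 <-> A i.+1 j)) ->
  forall i j i' j', i < m -> j < n -> i' < m -> j' < n ->
  A i.+1 j.+1 -> A i'.+1 j'.+1.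
Proof.
move=> A_V A_H i j i' j' im jn im' jn' Aij.
pose B (p : square m n) := A p.1.+1 p.2.+1.
have B_next p : B p -> B (next c p).
  have : adj (pos p) (pos (next c p)).
    by apply/adjP; exists p, (next c p); rewrite /joined eqxx.
  rewrite /B /pos; move: (nat_of_ord p.1) (nat_of_ord p.2) => a b.
  move: (nat_of_ord (next c p).1) (nat_of_ord (next c p).2) => a' b' adj_ab.
  have := adj_bounds adj_ab; rewrite /knight_step /= => /andP[+ _].
  have adj_ba := adj_ab; rewrite adj_sym in adj_ba.
  have adj_ab' := adj_ab; rewrite adj_cross in adj_ab'.
  have adj_ba' := adj_ba; rewrite adj_cross in adj_ba'.
  case/orP=> /andP[/orP[]/eqP-[e] /orP[]/eqP-[e']]; subst.
  - by have [[]] := A_V a'.+1 b'.+2 adj_ba.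
  - by have [_ []] := A_V a'.+1 b.+2 adj_ba'.
  - by have [_ []] := A_V a.+1 b'.+2 adj_ab'.
  - by have [[]] := A_V a.+1 b.+2 adj_ab.
  - by have [[]] := A_H a'.+2 b'.+1 adj_ba.
  - by have [_ []] := A_H a'.+2 b.+1 adj_ba'.
  - by have [_ []] := A_H a.+2 b'.+1 adj_ab'.
  - by have [[]] := A_H a.+2 b.+1 adj_ab.
have conn : fconnect (next c) (Ordinal im, Ordinal jn) (Ordinal im', Ordinal jn').
  by rewrite (fconnect_cycle (cycle_next Uc)).
suff : B (Ordinal im', Ordinal jn') by [].
by rewrite -(iter_findex conn); elim: (findex _ _ _) => // k; exact: B_next.
Qed.

End Tour.

Theorem theorem2 (m n : nat) (hm : 1 <= m) (hn : 1 <= n) :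
  ~ exists c : seq (square m n), closed_tour c /\ crosspatch (tour_moves c).
Proof.
case=> c [tour_c cross_c].
exact: (no_connected_crosses (@Vcross_bounds m n c tour_c)
  (@Hcross_bounds m n c tour_c) (two_crosses_tour tour_c cross_c) hm hn
  (tour_connect tour_c cross_c)).
Qed.
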